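(* Let $\mu,\nu$ be pre-permutons such that $\widetilde{\mathrm{LIS}}_\infty(\mu)=\widetilde{\mathrm{LIS}}_1(\mu)$ and $\widetilde{\mathrm{RS}}(\mu)=\widetilde{\mathrm{RS}}(\nu)$. Then $\mu^{\mathrm{incr}}=\nu^{\mathrm{incr}}$.
   Context: $\mathbb{N}^*=\{1,2,\dots\}$. A pre-permuton is a Borel probability measure on $[0,1]^2$ whose two marginals have no atoms. A subset $A\subset[0,1]^2$ is nondecreasing (resp. nonincreasing) if for all $(x_1,y_1),(x_2,y_2)\in A$, $(x_2-x_1)(y_2-y_1)\ge 0$ (resp. $\le 0$). It is $k$-nondecreasing (resp. $k$-nonincreasing) if it is a union of $k$ nondecreasing (resp. nonincreasing) subsets. For a finite Borel measure $\rho$ on $[0,1]^2$ and $k\in\mathbb{N}^*$, $\widetilde{\mathrm{LIS}}_k(\rho):=\sup_A \rho(A)$ over closed $k$-nondecreasing $A\subset[0,1]^2$, and $\widetilde{\mathrm{LDS}}_k(\rho):=\sup_A\rho(A)$ over closed $k$-nonincreasing $A$; $\widetilde{\mathrm{LIS}}_0(\rho)=\widetilde{\mathrm{LDS}}_0(\rho):=0$; $\widetilde{\mathrm{LIS}}_\infty:=\lim_k\widetilde{\mathrm{LIS}}_k$ and $\widetilde{\mathrm{LDS}}_\infty:=\lim_k\widetilde{\mathrm{LDS}}_k$. For $(x,y)\in[0,1]^2$, $\widetilde\lambda^\rho(x,y):=\big(\widetilde{\mathrm{LIS}}_k(\rho|_{[0,x]\times[0,y]})-\widetilde{\mathrm{LIS}}_{k-1}(\rho|_{[0,x]\times[0,y]})\big)_{k\in\mathbb{N}^*}$,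 with unnormalized restriction, and $\widetilde{\mathrm{RS}}(\rho):=\big(\widetilde\lambda^\rho(1,\cdot),\widetilde\lambda^\rho(\cdot,1)\big)$, a pair of functions on $[0,1]$. For a pre-permuton $\mu$, $\mu^{\mathrm{incr}}$ is the first component of the unique triple $(\mu^{\mathrm{incr}},\mu^{\mathrm{decr}},\mu^{\mathrm{sub}})$ of finite Borel measures on $[0,1]^2$ such that $\mu=\mu^{\mathrm{incr}}+\mu^{\mathrm{decr}}+\mu^{\mathrm{sub}}$, $\widetilde{\mathrm{LIS}}_\infty(\mu^{\mathrm{incr}})=\mu^{\mathrm{incr}}([0,1]^2)=\widetilde{\mathrm{LIS}}_\infty(\mu)$ and $\widetilde{\mathrm{LDS}}_\infty(\mu^{\mathrm{decr}})=\mu^{\mathrm{decr}}([0,1]^2)=\widetilde{\mathrm{LDS}}_\infty(\mu)$ (such a triple exists and is unique). *)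

(* Defs.v *)
From HB Require Import structures.
From mathcomp Require Import all_boot all_order all_algebra.
From mathcomp Require Import all_classical all_reals all_analysis.
From mathcomp Require Import measurable_realfun.

Set Implicit Arguments.
Unset Strict Implicit.
Unset Printing Implicit Defensive.
Import Order.TTheory GRing.Theory Num.Theory.
Import numFieldNormedType.Exports.
Local Open Scope classical_set_scope.
Local Open Scope ring_scope.

Definition unit_square (R : realType) : set (R * R) := `[0, 1] `*` `[0, 1].
Arguments unit_square : clear implicits.

(* Points of a Borel measure on R are its only possible atoms, hence the
   atomless condition on the marginals is stated on singletons. *)
Record prePermuton (R : realType) := PrePermuton {
  prePermuton_prob :> probability (R * R)%type R;
  prePermuton_supp : prePermuton_prob (unit_square R) = 1%E;
  prePermuton_fst : forall t : R,
    pushforward prePermuton_prob (fst : R * R -> R) [set t] = 0%E;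
  prePermuton_snd : forall t : R,
    pushforward prePermuton_prob (snd : R * R -> R) [set t] = 0%E
}.

Definition nondecreasing_set (R : realType) (A : set (R * R)) : Prop :=
  forall p q, A p -> A q -> 0 <= (q.1 - p.1) * (q.2 - p.2).

Definition nonincreasing_set (R : realType) (A : set (R * R)) : Prop :=
  forall p q, A p -> A q -> (q.1 - p.1) * (q.2 - p.2) <= 0.

Definition union_of (T : Type) (P : set T -> Prop) (k : nat) (A : set T) :=
  exists F : 'I_k -> set T, (forall i, P (F i)) /\ A = \bigcup_i F i.

Definition closed_union_of (R : realType) (P : set (R * R) -> Prop) (k : nat)
    (A : set (R * R)) : Prop :=
  [/\ closed A, A `<=` unit_square R & union_of P k A].

Definition max_mass (R : realType) (P : set (R * R) -> Prop)
    (rho : {measure set (R * R)%type -> \bar R}) (k : nat) : \bar R :=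
  if k is 0%N then 0%E else ereal_sup [set rho A | A in closed_union_of P k].

Definition LIS (R : realType) (rho : {measure set (R * R)%type -> \bar R}) :=
  max_mass (@nondecreasing_set R) rho.

Definition LDS (R : realType) (rho : {measure set (R * R)%type -> \bar R}) :=
  max_mass (@nonincreasing_set R) rho.

Definition LIS_infty (R : realType)
  (rho : {measure set (R * R)%type -> \bar R}) : \bar R := limn (LIS rho).

Definition LDS_infty (R : realType)
  (rho : {measure set (R * R)%type -> \bar R}) : \bar R := limn (LDS rho).

Lemma measurable_corner (R : realType) (x y : R) :
  measurable (`[0, x]%classic `*` `[0, y]%classic).
Proof. by apply: measurableX; exact: measurable_itv. Qed.

(* The paper's sequence, indexed by k >= 1, is here shifted to start at 0. *)
Definition shape (R : realType) (rho : {measure set (R * R)%type -> \bar R})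
    (x y : R) (k : nat) : \bar R :=
  let rho_xy := mrestr rho (measurable_corner x y) in
  (LIS rho_xy k.+1 - LIS rho_xy k)%E.

Definition RS (R : realType) (rho : {measure set (R * R)%type -> \bar R}) :
    (`[0%R : R, 1%R]%classic -> nat -> \bar R) *
    (`[0%R : R, 1%R]%classic -> nat -> \bar R) :=
  (fun y => shape rho 1 (set_val y), fun x => shape rho (set_val x) 1).

Definition decomposition (R : realType) (mu : prePermuton R)
    (t : {finite_measure set (R * R)%type -> \bar R} *
         {finite_measure set (R * R)%type -> \bar R} *
         {finite_measure set (R * R)%type -> \bar R}) : Prop :=
  let: (mu_incr, mu_decr, mu_sub) := t in
  [/\ forall A, measurable A ->
        mu A = (mu_incr A + mu_decr A + mu_sub A)%E,
      LIS_infty mu_incr = mu_incr (unit_square R) /\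
        mu_incr (unit_square R) = LIS_infty mu &
      LDS_infty mu_decr = mu_decr (unit_square R) /\
        mu_decr (unit_square R) = LDS_infty mu].

Lemma measurable_unit_square (R : realType) : measurable (unit_square R).
Proof. by apply: measurableX; exact: measurable_itv. Qed.

(* Hence the measurable sets of the product R * R are exactly its Borel sets. *)
Lemma closed_measurable_plane (R : realType) (A : set (R * R)) :
  closed A -> measurable A.
Proof.
move=> cA; rewrite -[A]setCK; apply: measurableC.
have oU : open (~` A) by exact: closed_openC.
move: oU; set U := ~` A => oU.
pose box (q : rat * rat * rat) : set (R * R) :=
  ball (ratr q.1.1 : R) (ratr q.2 : R) `*` ball (ratr q.1.2 : R) (ratr q.2 : R).
rewrite (_ : U = \bigcup_q (if `[< box q `<=` U >] then box q else set0)).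
  apply: countable_bigcupT_measurable => [|q]; first exact: countableP.
  case: ifP => _; last exact: measurable0.
  by apply: measurableX; exact: measurable_ball.
apply/seteqP; split => [[x y] Uxy|p [q _]]; last by case: asboolP => // /[apply].
have /nbhs_ballP[e /= e0 eU] : nbhs (x, y) U by exact: open_nbhs_nbhs.
have [r /[!in_itv]/= /andP[r0 re]] : exists q : rat, ratr q \in `]0, (e / 2)[.
  by apply: rat_in_itvoo; rewrite divr_gt0.
have rat_near (z : R) : exists a : rat, `|ratr a - z| < ratr r.
  have [a] : exists a : rat, ratr a \in `](z - ratr r), (z + ratr r)[.
    by apply: rat_in_itvoo; rewrite ltrBlDr -addrA ltrDl addr_gt0.
  by rewrite in_itv/= -ltr_distl => ?; exists a.
have [a ax] := rat_near x; have [b yb] := rat_near y.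
exists (a, b, r) => //; case: asboolP => [_|[]]; first by split.
move=> [u v] [/=]; rewrite /ball/= => au bv; apply: eU; split => /=.
- rewrite /ball/= (le_lt_trans (ler_distD (ratr a) _ _))// [e]splitr ltrD//.
    by rewrite distrC (lt_trans ax).
  by rewrite (lt_trans au).
- rewrite /ball/= (le_lt_trans (ler_distD (ratr b) _ _))// [e]splitr ltrD//.
    by rewrite distrC (lt_trans yb).
  by rewrite (lt_trans bv).
Qed.

Section max_mass_theory.
Variables (R : realType) (P : set (R * R) -> Prop).
Hypothesis P0 : P set0.
Implicit Types rho : {measure set (R * R)%type -> \bar R}.

Lemma union_ofU j k A B : union_of P j A -> union_of P k B ->
  union_of P (j + k) (A `|` B).
Proof.
move=> [F [PF ->]] [G [PG ->]].
exists (fun i : 'I_(j + k) => match fintype.split i with inl a => F a | inr b => G b end).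
split=> [i|]; first by case: (fintype.split i).
apply/seteqP; split => p.
- move=> [] [i _ pi].
  + exists (lshift k i) => //; case: splitP => [a /= ia|b /= ib].
      by rewrite (_ : a = i)//; apply/val_inj.
    by have := ltn_ord i; rewrite ib ltnNge leq_addr.
  + exists (rshift j i) => //; case: splitP => [a /= ia|b /= /addnI ib].
      by have := ltn_ord a; rewrite -ia ltnNge leq_addr.
    by rewrite (_ : b = i)//; apply/val_inj.
- by move=> [i _]; case: (fintype.split i) => a pa; [left|right]; exists a.
Qed.

Lemma closed_union_ofU j k A B : closed_union_of P j A ->
  closed_union_of P k B -> closed_union_of P (j + k) (A `|` B).
Proof.
move=> [cA sA uA] [cB sB uB]; split; first exact: closedU.
- by rewrite subUset.
- exact: union_ofU.
Qed.

Lemma closed_union_of0 k : closed_union_of P k set0.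
Proof.
split; [exact: closed0|exact: sub0set|exists (fun=> set0); split=> //].
by rewrite bigcup0.
Qed.

Lemma closed_union_of_measurable k A : closed_union_of P k A -> measurable A.
Proof. by case=> + _ _; exact: closed_measurable_plane. Qed.

Lemma max_mass_ge rho k A : closed_union_of P k A ->
  (rho A <= max_mass P rho k)%E.
Proof.
case: k => [[_ _ [F [_ ->]]]|k HA] /=; last first.
  by apply: ereal_sup_ubound; exists A.
by rewrite (_ : \bigcup_i _ = set0) ?measure0// -subset0 => x [[]].
Qed.

Lemma max_mass_le rho k M :
  (forall A, closed_union_of P k A -> (rho A <= M)%E) ->
  (max_mass P rho k <= M)%E.
Proof.
move=> H; case: k H => [|k] H /=; last by apply: ge_ereal_sup => _ [A /H ? <-].
by rewrite -(measure0 rho); apply: H; exact: closed_union_of0.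
Qed.

Lemma max_mass_homo rho :
  {homo max_mass P rho : m n / (m <= n)%N >-> (m <= n)%E}.
Proof.
move=> m n mn; apply: max_mass_le => A HA.
apply: max_mass_ge; rewrite -(subnKC mn) -[A]setU0.
by apply: closed_union_ofU => //; exact: closed_union_of0.
Qed.

Lemma max_mass_lim rho :
  limn (max_mass P rho) = ereal_sup (range (max_mass P rho)).
Proof.
by apply/cvg_lim => //; apply: ereal_nondecreasing_cvgn; exact: max_mass_homo.
Qed.

Lemma max_mass_lim_ge rho k A : closed_union_of P k A ->
  (rho A <= limn (max_mass P rho))%E.
Proof.
move=> HA; rewrite max_mass_lim (le_trans (max_mass_ge rho HA))//.
by apply: ereal_sup_ubound; exists k.
Qed.

Lemma max_mass_lim_le rho M :
  (forall k A, closed_union_of P k A -> (rho A <= M)%E) ->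
  (limn (max_mass P rho) <= M)%E.
Proof.
move=> H; rewrite max_mass_lim; apply: ge_ereal_sup => _ [k _ <-].
by apply: max_mass_le; exact: H.
Qed.

Lemma max_mass_lim_bigcup_le (rho : {measure set (R * R)%type -> \bar R})
    (B : nat -> set (R * R)) :
  (forall n, exists k, closed_union_of P k (B n)) ->
  {homo B : m n / (m <= n)%N >-> m `<=` n} ->
  (rho (\bigcup_n B n) <= limn (max_mass P rho))%E.
Proof.
move=> BH Bh.
have mB n : measurable (B n) by have [k /closed_union_of_measurable] := BH n.
have mU : measurable (\bigcup_n B n) by exact: bigcup_measurable.
have cB : (rho \o B) x @[x --> \oo] --> rho (\bigcup_n B n).
  by apply: nondecreasing_cvg_mu => // m n /Bh; rewrite subsetEset.
rewrite -(cvg_lim _ cB)//; apply: lime_le; first by apply/cvg_ex; eexists; exact: cB.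
by apply: nearW => n /=; have [k] := BH n; exact: max_mass_lim_ge.
Qed.

Lemma max_mass_lim_attained (rho : {finite_measure set (R * R)%type -> \bar R}) :
  exists B : nat -> set (R * R),
    [/\ forall n, exists k, closed_union_of P k (B n),
        {homo B : m n / (m <= n)%N >-> m `<=` n} &
        rho (\bigcup_n B n) = limn (max_mass P rho)].
Proof.
set L := limn _.
have Lfin : L \is a fin_num.
  apply/fin_numPlt; rewrite (@lt_le_trans _ _ 0%E)//=; last first.
    by rewrite -(measure0 rho); exact: (max_mass_lim_ge _ (closed_union_of0 0)).
  apply: (@le_lt_trans _ _ (rho setT)).
    apply: max_mass_lim_le => k A /closed_union_of_measurable mA.
    by apply: le_measure; rewrite ?inE.
  by rewrite -ge0_fin_numE ?measure_ge0// fin_num_measure.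
have /choice[A HA] n : exists An,
    (exists k, closed_union_of P k An) /\ (L - (n.+1%:R^-1)%:E < rho An)%E.
  have := Lfin; rewrite /L max_mass_lim => /ub_ereal_sup_adherent.
  move=> /(_ n.+1%:R^-1) []; first by rewrite invr_gt0.
  move=> _ [k _ <-] kL.
  case: (pselect (exists B, closed_union_of P k B /\
    (ereal_sup (range (max_mass P rho)) - (n.+1%:R^-1)%:E < rho B)%E)).
    by move=> [B [HB BL]]; exists B; split=> //; exists k.
  move=> /forallNP H; exfalso; move: kL; apply/negP; rewrite -leNgt.
  apply: max_mass_le => B HB; rewrite leNgt; apply/negP => BL.
  by apply: (H B); split.
pose B n := \big[setU/set0]_(i < n.+1) A i.
have BH n : exists k, closed_union_of P k (B n).
  rewrite /B; elim: n => [|n [k IH]].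
    by rewrite big_ord_recr big_ord0/= set0U; have [] := HA 0%N.
  rewrite big_ord_recr/=; have [[j Aj] _] := HA n.+1.
  by exists (k + j)%N; exact: closed_union_ofU.
have mB n : measurable (B n) by have [k /closed_union_of_measurable] := BH n.
have Bh : {homo B : m n / (m <= n)%N >-> m `<=` n}.
  by move=> m n mn; exact: subset_bigsetU.
have mU : measurable (\bigcup_n B n) by exact: bigcup_measurable.
exists B; split => //.
apply/eqP; rewrite eq_le; apply/andP; split.
  exact: max_mass_lim_bigcup_le.
apply/lee_addgt0Pr => e e0.
have [n ne] : exists n, n.+1%:R^-1 < e.
  have := near_infty_natSinv_lt (PosNum e0) => -[n _ /(_ n (leqnn n)) /= ?].
  by exists n.
rewrite -leeBlDr// (@le_trans _ _ (rho (A n)))//.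
  apply/ltW; apply: le_lt_trans (HA n).2.
  by apply: leeB => //; rewrite lee_fin ltW.
apply: le_measure; rewrite ?inE//.
  by have [[k /closed_union_of_measurable]] := HA n.
apply: (@subset_trans _ (B n)); last exact: bigcup_sup.
by rewrite /B big_ord_recr/=; exact: subsetUr.
Qed.

Lemma max_mass_lim_restr (rho : {measure set (R * R)%type -> \bar R})
    (rho' : {measure set (R * R)%type -> \bar R}) (B : nat -> set (R * R)) :
  (forall n, exists k, closed_union_of P k (B n)) ->
  {homo B : m n / (m <= n)%N >-> m `<=` n} ->
  (forall A, measurable A -> rho' A = rho (A `&` \bigcup_n B n)) ->
  limn (max_mass P rho') = rho (\bigcup_n B n) /\
  rho' (unit_square R) = rho (\bigcup_n B n).
Proof.
move=> BH Bh rho'E.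
have mB n : measurable (B n) by have [k /closed_union_of_measurable] := BH n.
have mU : measurable (\bigcup_n B n) by exact: bigcup_measurable.
split; last first.
  rewrite rho'E; last exact: measurable_unit_square.
  by congr (rho _); apply: setIidr => p [n _]; have [k [_ + _]] := BH n; exact.
apply/eqP; rewrite eq_le; apply/andP; split.
  apply: max_mass_lim_le => k A /closed_union_of_measurable mA.
  rewrite rho'E//; apply: le_measure; rewrite ?inE//.
  by exact: measurableI.
have cB : (rho \o B) x @[x --> \oo] --> rho (\bigcup_n B n).
  by apply: nondecreasing_cvg_mu => // m n /Bh; rewrite subsetEset.
rewrite -(cvg_lim _ cB)//; apply: lime_le; first by apply/cvg_ex; eexists; exact: cB.
apply: nearW => n /=; have [k Bk] := BH n.
rewrite (_ : rho (B n) = rho' (B n)); first exact: max_mass_lim_ge Bk.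
by rewrite rho'E//; congr (rho _); rewrite setIidl//; exact: bigcup_sup.
Qed.

Lemma max_mass_lim_attained_unique
    (rho : {finite_measure set (R * R)%type -> \bar R})
    (B C : nat -> set (R * R)) (A : set (R * R)) :
  (forall n, exists k, closed_union_of P k (B n)) ->
  {homo B : m n / (m <= n)%N >-> m `<=` n} ->
  rho (\bigcup_n B n) = limn (max_mass P rho) ->
  (forall n, exists k, closed_union_of P k (C n)) ->
  {homo C : m n / (m <= n)%N >-> m `<=` n} ->
  rho (\bigcup_n C n) = limn (max_mass P rho) ->
  measurable A ->
  rho (A `&` \bigcup_n B n) = rho (A `&` \bigcup_n C n).
Proof.
move=> BH Bh BL CH Ch CL mA.
have mB n : measurable (B n) by have [k /closed_union_of_measurable] := BH n.
have mC n : measurable (C n) by have [k /closed_union_of_measurable] := CH n.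
have mU : measurable (\bigcup_n B n) by exact: bigcup_measurable.
have mV : measurable (\bigcup_n C n) by exact: bigcup_measurable.
have UVL : (rho (\bigcup_n B n `|` \bigcup_n C n) <= limn (max_mass P rho))%E.
  rewrite -bigcupU; apply: max_mass_lim_bigcup_le => [n|m n mn].
    have [j Bj] := BH n; have [k Ck] := CH n.
    by exists (j + k)%N; exact: closed_union_ofU.
  by apply: setUSS; [exact: Bh|exact: Ch].
set L := limn _ in UVL BL CL; set U := \bigcup_n B n in mU UVL BL *.
set V := \bigcup_n C n in mV UVL CL *.
have D0 X Y : measurable X -> measurable Y -> rho Y = L ->
    (rho (X `|` Y) <= L)%E -> rho (A `&` X) = rho (A `&` X `&` Y).
  move=> mX mY YL XYL; have mD : measurable (X `\` Y) by exact: measurableD.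
  have mAX : measurable (A `&` X) by exact: measurableI.
  have XY0 : rho (X `\` Y) = 0%E.
    apply/eqP; rewrite -measure_le0 -(@leeD2rE _ (rho Y)) ?fin_num_measure//.
    rewrite add0e [leRHS]YL (le_trans _ XYL)//.
    rewrite (measureDI rho (measurableU _ _ mX mY) mY).
    by rewrite setDUl setDv setU0 setIC setKU.
  rewrite [LHS](measureDI rho mAX mY) [X in (X + _)%E](_ : _ = 0%E) ?add0e//.
  apply: (subset_measure0 _ mD _ XY0); first exact: measurableD.
  by apply: setSD; exact: subIsetr.
by rewrite (D0 U V)// (D0 V U) ?(setUC V)// setIAC.
Qed.

Lemma max_mass_lim_component
    (mu rho : {finite_measure set (R * R)%type -> \bar R})
    (rest : {measure set (R * R)%type -> \bar R}) :
  (forall A, measurable A -> mu A = (rho A + rest A)%E) ->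
  limn (max_mass P rho) = rho setT ->
  limn (max_mass P rho) = limn (max_mass P mu) ->
  exists B : nat -> set (R * R),
    [/\ forall n, exists k, closed_union_of P k (B n),
        {homo B : m n / (m <= n)%N >-> m `<=` n},
        mu (\bigcup_n B n) = limn (max_mass P mu) &
        forall A, measurable A -> rho A = mu (A `&` \bigcup_n B n)].
Proof.
move=> muE rhoT rhomu; have [B [BH Bh BL]] := max_mass_lim_attained rho.
exists B.
have mB n : measurable (B n) by have [k /closed_union_of_measurable] := BH n.
have mU : measurable (\bigcup_n B n) by exact: bigcup_measurable.
have := max_mass_lim_bigcup_le mu BH Bh.
set U := \bigcup_n B n in mU BL * => muU.
have rest0 : rest U = 0%E.
  apply/eqP; rewrite -measure_le0 -(@leeD2lE _ (rho U)) ?fin_num_measure//.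
  by rewrite -muE// adde0 [leRHS]BL rhomu.
have rhoC0 : rho (setT `\` U) = 0%E.
  apply/eqP; rewrite -measure_le0 -(@leeD2rE _ (rho U)) ?fin_num_measure//.
  by rewrite add0e [leRHS]BL rhoT (measureDI rho measurableT mU) setTI.
split=> //; first by rewrite muE// rest0 adde0 BL.
move=> A mA; rewrite muE; last exact: measurableI.
have -> : rest (A `&` U) = 0%E.
  by apply: (subset_measure0 _ mU _ rest0); [exact: measurableI|exact: subIsetr].
rewrite adde0 [LHS](measureDI rho mA mU).
rewrite [X in (X + _)%E](_ : _ = 0%E) ?add0e//.
have mD : measurable (setT `\` U) by exact: measurableD.
by apply: (subset_measure0 _ mD _ rhoC0); [exact: measurableD|exact: setSD].
Qed.

End max_mass_theory.

Lemma nondecreasing_nonincreasing_negligible (R : realType)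
    (mu : prePermuton R) (A B : set (R * R)) :
  nondecreasing_set A -> nonincreasing_set B -> mu.-negligible (A `&` B).
Proof.
move=> Ai Bd.
have E p q : (A `&` B) p -> (A `&` B) q -> p.1 = q.1 \/ p.2 = q.2.
  move=> [Ap Bp] [Aq Bq].
  have /eqP : (q.1 - p.1) * (q.2 - p.2) = 0.
    by apply/eqP; rewrite eq_le Ai// Bd.
  by rewrite mulf_eq0 !subr_eq0 => /orP[] /eqP ->; [left|right].
have vert (t : R) : mu.-negligible (fst @^-1` [set t] : set (R * R)).
  apply/negligibleP; last exact: (prePermuton_fst mu t).
  rewrite -[X in measurable X]setTI; apply: measurable_fst => //.
have horz (t : R) : mu.-negligible (snd @^-1` [set t] : set (R * R)).
  apply/negligibleP; last exact: (prePermuton_snd mu t).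
  rewrite -[X in measurable X]setTI; apply: measurable_snd => //.
case: (pselect (exists p q, [/\ (A `&` B) p, (A `&` B) q & p.1 != q.1])).
  move=> [p [q [Ep Eq pq]]]; apply: negligibleS (horz p.2) => r Er /=.
  have [rp|//] := E r p Er Ep; have [rq|->] := E r q Er Eq.
    by move: pq; rewrite -rp -rq eqxx.
  by have [/eqP|//] := E p q Ep Eq; rewrite (negbTE pq).
move=> H; case: (pselect (A `&` B = set0)) => [->|/eqP/set0P[p Ep]].
  exact: negligible_set0.
apply: negligibleS (vert p.1) => r Er /=; apply: contrapT => /eqP rp.
by apply: H; exists r, p.
Qed.

Lemma negligible_bigcup_ord (R : realType)
    (mu : {measure set (R * R)%type -> \bar R}) k (F : 'I_k -> set (R * R)) :
  (forall i, mu.-negligible (F i)) -> mu.-negligible (\bigcup_i F i).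
Proof.
move=> HF.
apply: (@negligibleS _ _ _ _ (\bigcup_n (if insub n is Some i then F i else set0))).
  by move=> p [i _ Fp]; exists (val i) => //; rewrite valK.
by apply: negligible_bigcup => n; case: insub => // *; exact: negligible_set0.
Qed.

Lemma nondecreasing_set0 (R : realType) : @nondecreasing_set R set0.
Proof. by move=> p q []. Qed.

Lemma nonincreasing_set0 (R : realType) : @nonincreasing_set R set0.
Proof. by move=> p q []. Qed.

Lemma decomposition_exists (R : realType) (mu : prePermuton R) :
  exists t, decomposition mu t.
Proof.
have [B [BH Bh BL]] := max_mass_lim_attained (@nondecreasing_set0 R) mu.
have [C [CH Ch CL]] := max_mass_lim_attained (@nonincreasing_set0 R) mu.
have mB n : measurable (B n) by have [k /closed_union_of_measurable] := BH n.
have mC n : measurable (C n) by have [k /closed_union_of_measurable] := CH n.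
have mI : measurable (\bigcup_n B n) by exact: bigcup_measurable.
have mD : measurable (\bigcup_n C n) by exact: bigcup_measurable.
have ID0 : mu.-negligible (\bigcup_n B n `&` \bigcup_n C n).
  rewrite setI_bigcupl; apply: negligible_bigcup => m.
  rewrite setI_bigcupr; apply: negligible_bigcup => n.
  have [j [_ _ [F [HF ->]]]] := BH m; have [k [_ _ [G [HG ->]]]] := CH n.
  rewrite setI_bigcupl; apply: negligible_bigcup_ord => a.
  rewrite setI_bigcupr; apply: negligible_bigcup_ord => b.
  exact: nondecreasing_nonincreasing_negligible.
set I := \bigcup_n B n in mI ID0 BL *; set D := \bigcup_n C n in mD ID0 CL *.
have mS : measurable (~` (I `|` D)).
  by apply: measurableC; exact: measurableU.
have fin X : measurable X -> (mu X < +oo)%E.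
  by move=> mX; rewrite (le_lt_trans (probability_le1 mu mX))// ltry.
exists (mfrestr mI (fin _ mI) : {finite_measure set _ -> \bar _},
        mfrestr mD (fin _ mD) : {finite_measure set _ -> \bar _},
        mfrestr mS (fin _ mS) : {finite_measure set _ -> \bar _}).
split.
- move=> A mA; rewrite /= /mfrestr /mrestr.
  have mAI : measurable (A `&` I) by exact: measurableI.
  have mAD : measurable (A `&` D) by exact: measurableI.
  rewrite (measureDI mu mA (measurableU _ _ mI mD)) addeC; congr (_ + _)%E.
  rewrite setIUr; apply: etrans (measureUfinl mAI mAD (fin _ mAI)) _.
  rewrite [X in (_ - X)%E](_ : _ = 0%E) ?sube0//.
  apply: (negligibleP mu (measurableI _ _ mAI mAD)).1.
  by apply: negligibleS ID0 => p [[_ ?] [_ ?]].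
- have [h1 h2] := max_mass_lim_restr (rho := mu)
    (rho' := mfrestr mI (fin _ mI)) (@nondecreasing_set0 R) BH Bh (fun _ _ => erefl).
  by rewrite /LIS_infty /LIS h1 h2.
- have [h1 h2] := max_mass_lim_restr (rho := mu)
    (rho' := mfrestr mD (fin _ mD)) (@nonincreasing_set0 R) CH Ch (fun _ _ => erefl).
  by rewrite /LDS_infty /LDS h1 h2.
Qed.

Lemma prePermuton_setT (R : realType) (mu : prePermuton R)
    (rho rest : {measure set (R * R)%type -> \bar R}) :
  (forall A, measurable A -> mu A = (rho A + rest A)%E) ->
  rho setT = rho (unit_square R).
Proof.
move=> muE; have mS := @measurable_unit_square R.
have mC : measurable (setT `\` unit_square R) by exact: measurableD.
have muC : mu (setT `\` unit_square R) = 0%E.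
  rewrite setTD; apply: etrans (probability_setC mu mS) _.
  by rewrite prePermuton_supp subee.
have rhoC : rho (setT `\` unit_square R) = 0%E.
  apply/eqP; rewrite -measure_le0 -[leRHS]muC muE//.
  by rewrite leeDl.
by rewrite (measureDI rho measurableT mS) [X in (X + _)%E]rhoC add0e setTI.
Qed.

Lemma decomposition_unique (R : realType) (mu : prePermuton R) s t
    (A : set (R * R)) :
  decomposition mu s -> decomposition mu t -> measurable A ->
  [/\ s.1.1 A = t.1.1 A, s.1.2 A = t.1.2 A & s.2 A = t.2 A].
Proof.
move: s t => [[i d] r] [[i' d'] r'].
move=> [E [hi1 hi2] [hd1 hd2]] [E' [hi1' hi2'] [hd1' hd2']] mA /=.
pose add (m1 m2 : {finite_measure set (R * R)%type -> \bar R}) :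
  {measure set (R * R)%type -> \bar R} := measure_add m1 m2.
have addE m1 m2 B : add m1 m2 B = (m1 B + m2 B)%E by exact: measure_addE.
have key P (P0 : P set0)
    (m m' : {finite_measure set (R * R)%type -> \bar R})
    (n n' : {measure set (R * R)%type -> \bar R}) :
    (forall B, measurable B -> mu B = (m B + n B)%E) ->
    (forall B, measurable B -> mu B = (m' B + n' B)%E) ->
    limn (max_mass P m) = m (unit_square R) ->
    m (unit_square R) = limn (max_mass P mu) ->
    limn (max_mass P m') = m' (unit_square R) ->
    m' (unit_square R) = limn (max_mass P mu) -> m A = m' A.
  move=> H H' h1 h2 h1' h2'.
  have [B [BH Bh BL ->//]] : exists B : nat -> set (R * R),
      [/\ forall n, exists k, closed_union_of P k (B n),
          {homo B : m n / (m <= n)%N >-> m `<=` n},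
          mu (\bigcup_n B n) = limn (max_mass P mu) &
          forall A, measurable A -> m A = mu (A `&` \bigcup_n B n)].
    apply: (max_mass_lim_component P0 H); last by rewrite h1.
    by rewrite h1 (prePermuton_setT H).
  have [C [CH Ch CL ->//]] : exists B : nat -> set (R * R),
      [/\ forall n, exists k, closed_union_of P k (B n),
          {homo B : m n / (m <= n)%N >-> m `<=` n},
          mu (\bigcup_n B n) = limn (max_mass P mu) &
          forall A, measurable A -> m' A = mu (A `&` \bigcup_n B n)].
    apply: (max_mass_lim_component P0 H'); last by rewrite h1'.
    by rewrite h1' (prePermuton_setT H').
  exact: max_mass_lim_attained_unique BL CH Ch CL mA.
have iE : i A = i' A.
  apply: (key _ (@nondecreasing_set0 R) _ _ (add d r) (add d' r')) => // B mB.
    by rewrite E// addE addeA.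
  by rewrite E'// addE addeA.
have dE : d A = d' A.
  apply: (key _ (@nonincreasing_set0 R) _ _ (add i r) (add i' r')) => // B mB.
    by rewrite E// addE [RHS]addeA [X in _ = (X + _)%E]addeC.
  by rewrite E'// addE [RHS]addeA [X in _ = (X + _)%E]addeC.
have F : (i A + d A)%E \is a fin_num by rewrite fin_numD !fin_num_measure.
have RE : (i A + d A + r A = i A + d A + r' A)%E.
  rewrite -[LHS](E A mA) (E' A mA); congr (_ + _)%E.
  by congr (_ + _)%E.
split=> //; apply/eqP.
by rewrite eq_le -(leeD2lE (r A) (r' A) F) -(leeD2lE (r' A) (r A) F) RE lexx.
Qed.

(* The choice of a triple is harmless: by decomposition_unique it is unique as a
   triple of Borel measures, i.e. up to its values on nonmeasurable sets. *)
Definition mu_incr (R : realType) (mu : prePermuton R) :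
    {finite_measure set (R * R)%type -> \bar R} :=
  (projT1 (cid (decomposition_exists mu))).1.1.

(* Main.v *)
(* Since LIS_infty mu = LIS_1 mu, the measure mu^incr is carried, up to arbitrarily
   small mass, by a single nondecreasing set, so LIS_1 of mu restricted to D is
   mu^incr(D). Equality of RS makes the same true of nu, and its values at
   k = 1 say that mu^incr and nu^incr have the same marginals. A measure
   carried by a nondecreasing set is the comonotone coupling of its marginals:
   the mass of a quadrant is the smaller of the masses of the two half-planes
   it is the intersection of. Hence the two measures coincide. *)
Require Import Defs.
From mathcomp Require Import all_boot all_order all_algebra.
From mathcomp Require Import all_classical all_reals all_analysis.
From mathcomp Require Import measurable_realfun.

Set Implicit Arguments.
Unset Strict Implicit.
Unset Printing Implicit Defensive.
Import Order.TTheory GRing.Theory Num.Theory.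
Local Open Scope classical_set_scope.
Local Open Scope ring_scope.

(** * Measures determined by rays and by quadrants *)

Lemma measure_unique_rays (R : realType) (m1 m2 : {measure set R -> \bar R}) :
  (forall x, m1 `]x, +oo[%classic = m2 `]x, +oo[%classic) ->
  (forall x, m1 `]x, +oo[%classic < +oo)%E ->
  forall A, measurable A -> m1 A = m2 A.
Proof.
move=> m12 m1oo A mA.
apply: (measure_unique (@RGenOInfty.G R) (fun k => `](- k%:R), +oo[%classic)) => //.
- exact: RGenOInfty.measurableE.
- move=> _ _ [x ->] [y ->]; exists (Num.max x y).
  by apply/seteqP; split => z /=; rewrite !in_itv/= !andbT gt_max => /andP.
- by move=> k; exists (- k%:R).
(* The rays starting at [- k] exhaust the line: [k] only has to exceed [|x|]. *)
- apply/seteqP; split => // x _; exists (Num.truncn `|x|).+1 => //=.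
  rewrite in_itv/= andbT ltrNl (le_lt_trans (ler_norm _))// normrN.
  by rewrite -truncn_le_nat.
- by move=> _ [x ->].
Qed.

(** One-dimensional uniqueness is applied to one coordinate at a time: first the horizontal side of
    a quadrant is freed, then the vertical one. This reaches all measurable rectangles, a generating
    family stable under intersection. *)
Lemma measure_unique_quadrants (R : realType)
    (m1 m2 : {finite_measure set (R * R)%type -> \bar R}) :
  (forall x y, m1 (`]x, +oo[ `*` `]y, +oo[) = m2 (`]x, +oo[ `*` `]y, +oo[)) ->
  forall A, measurable A -> m1 A = m2 A.
Proof.
move=> m12.
have fin (m : {finite_measure set (R * R)%type -> \bar R}) A :
    measurable A -> (m A < +oo)%E.
  by move=> mA; rewrite -ge0_fin_numE// fin_num_measure.
(* With one side of the rectangle frozen in [D], the mass becomes a measure on the line in the other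
   side. *)
have pre f (mf : measurable_fun [set: R * R] f) D (mD : measurable D)
    (m : {finite_measure set (R * R)%type -> \bar R}) :
    exists p : {measure set R -> \bar R}, forall X, p X = m (f @^-1` X `&` D).
  by unshelve eexists (pushforward (mrestr m mD) f).
have strip y (X : set R) : measurable X ->
    m1 (X `*` `]y, +oo[) = m2 (X `*` `]y, +oo[).
  have mD : measurable ([set: R] `*` `]y, +oo[%classic).
    by apply: measurableX => //; exact: measurable_itv.
  have [p1 p1E] := pre fst measurable_fst _ mD m1.
  have [p2 p2E] := pre fst measurable_fst _ mD m2.
  have E Y : Y `*` `]y, +oo[ = fst @^-1` Y `&` (setT `*` `]y, +oo[).
    by apply/seteqP; split => -[a b] /= [] // ? [].
  move=> mX; rewrite E -p1E -p2E; apply: measure_unique_rays mX => x.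
    by rewrite p1E p2E -E.
  by rewrite p1E -E; apply: fin; apply: measurableX; exact: measurable_itv.
have rect X Y : measurable X -> measurable Y -> m1 (X `*` Y) = m2 (X `*` Y).
  move=> mX; have mD : measurable (X `*` [set: R]) by exact: measurableX.
  have [p1 p1E] := pre snd measurable_snd _ mD m1.
  have [p2 p2E] := pre snd measurable_snd _ mD m2.
  have E Z : X `*` Z = snd @^-1` Z `&` (X `*` setT).
    by apply/seteqP; split => -[a b] /= [] // ? [].
  move=> mY; rewrite E -p1E -p2E; apply: measure_unique_rays mY => y.
    by rewrite p1E p2E -E strip.
  by rewrite p1E -E; apply: fin; apply: measurableX => //; exact: measurable_itv.
move=> A mA.
apply: (measure_unique [set X `*` Y | X in measurable & Y in measurable]
  (fun=> setT)) => //.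
- exact: measurable_prod_measurableType.
- move=> _ _ [X mX [Y mY <-]] [X' mX' [Y' mY' <-]]; rewrite -setXI.
  by exists (X `&` X'); [exact: measurableI|exists (Y `&` Y') => //; exact: measurableI].
- by move=> _; exists setT => //; exists setT => //; rewrite setXTT.
- by rewrite bigcup_const.
- by move=> _ [X mX [Y mY <-]]; exact: rect.
- by move=> _; exact: fin.
Qed.

(** * Measures carried by nondecreasing sets *)

(** An error [e] is allowed because [LIS] is a supremum: it directly supplies only nearly optimal
    sets. *)
Definition comonotone (R : realType)
    (m : {finite_measure set (R * R)%type -> \bar R}) : Prop :=
  forall e, 0 < e ->
    exists A, [/\ measurable A, nondecreasing_set A & (m (~` A) <= e%:E)%E].

(* A nondecreasing set cannot meet both the upper left and the lower right
   quadrant at (x, y), so off a small set one half-plane contains the other. *)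
Lemma comonotone_quadrant (R : realType)
    (m : {finite_measure set (R * R)%type -> \bar R}) x y :
  comonotone m ->
  m (`]x, +oo[ `*` `]y, +oo[) =
  Order.min (m (`]x, +oo[ `*` [set: R])) (m ([set: R] `*` `]y, +oo[)).
Proof.
move=> mC.
set S := `]x, +oo[ `*` [set: R]; set T := [set: R] `*` `]y, +oo[.
have mS : measurable S by apply: measurableX => //; exact: measurable_itv.
have mT : measurable T by apply: measurableX => //; exact: measurable_itv.
have mST := measurableI _ _ mS mT.
have -> : `]x, +oo[ `*` `]y, +oo[ = S `&` T.
  by rewrite /S /T -setXI setIT setTI.
apply/eqP; rewrite eq_le; apply/andP; split.
  by rewrite le_min !le_measure ?inE//.
apply/lee_addgt0Pr => e /mC[A [mA Ai Ae]].
have mCA : measurable (~` A) by exact: measurableC.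
suff [ST|TS] : S `&` A `<=` T \/ T `&` A `<=` S.
- rewrite ge_min; apply/orP; left.
  apply: (@le_trans _ _ (m (S `&` T) + m (~` A))%E); last exact: leeD.
  apply: le_trans (measureU2 _ mST mCA); apply: le_measure; rewrite ?inE//.
    exact: measurableU.
  by move=> p Sp; have [Ap|] := pselect (A p); [left; split => //; exact: ST|right].
- rewrite ge_min; apply/orP; right.
  apply: (@le_trans _ _ (m (S `&` T) + m (~` A))%E); last exact: leeD.
  apply: le_trans (measureU2 _ mST mCA); apply: le_measure; rewrite ?inE//.
    exact: measurableU.
  by move=> p Tp; have [Ap|] := pselect (A p); [left; split => //; exact: TS|right].
apply: contrapT => /not_orP[/existsNP[p /not_implyP[[[px _] Ap] pT]]].
move=> /existsNP[q /not_implyP[[[_ qy] Aq] qS]].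
have {}px : x < p.1 by move: px; rewrite /= in_itv/= andbT.
have {}qy : y < q.2 by move: qy; rewrite /= in_itv/= andbT.
have py : p.2 <= y.
  by rewrite leNgt; apply/negP => py; apply: pT; split => //=; rewrite in_itv/= py.
have qx : q.1 <= x.
  by rewrite leNgt; apply/negP => qx; apply: qS; split => //=; rewrite in_itv/= qx.
have := Ai p q Ap Aq; apply/negP; rewrite -ltNge nmulr_rlt0 ?subr_gt0 ?subr_lt0.
  exact: le_lt_trans qy.
exact: le_lt_trans px.
Qed.

Lemma comonotone_measure_unique (R : realType)
    (m1 m2 : {finite_measure set (R * R)%type -> \bar R}) :
  comonotone m1 -> comonotone m2 ->
  (forall x, m1 (`]x, +oo[ `*` [set: R]) = m2 (`]x, +oo[ `*` [set: R])) ->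
  (forall y, m1 ([set: R] `*` `]y, +oo[) = m2 ([set: R] `*` `]y, +oo[)) ->
  forall A, measurable A -> m1 A = m2 A.
Proof.
move=> c1 c2 m12x m12y; apply: measure_unique_quadrants => x y.
by rewrite !comonotone_quadrant// m12x m12y.
Qed.

(** * The increasing component and LIS of restrictions *)

Lemma mu_incr_setT (R : realType) (mu : prePermuton R) :
  mu_incr mu setT = mu_incr mu (unit_square R) /\
  mu_incr mu setT = LIS_infty mu.
Proof.
rewrite /mu_incr; case: (cid _) => -[[i d] s] /= [muE [_ iL] _].
pose rest : {measure set (R * R)%type -> \bar R} := measure_add d s.
have restE B : rest B = (d B + s B)%E by exact: measure_addE.
suff -> : i setT = i (unit_square R) by [].
apply: (@prePermuton_setT R mu i rest) => A mA.
by rewrite restE addeA muE.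
Qed.

(** The increasing component is [mu] restricted to a union [U] of closed k-nondecreasing sets, k
    varying, whose mass is already [LIS_infty mu]. Adjoining [A] to [U] cannot exceed this supremum,
    so [mu] gives no mass to the part of [A] outside [U]. *)
Lemma mu_incr_closed_union (R : realType) (mu : prePermuton R) k A D :
  closed_union_of (@nondecreasing_set R) k A -> measurable D ->
  mu_incr mu (A `&` D) = mu (A `&` D).
Proof.
have [] := mu_incr_setT mu.
rewrite /mu_incr; case: (cid _) => -[[i d] s] /= [muE [iT _] _] isq iL.
pose rest : {measure set (R * R)%type -> \bar R} := measure_add d s.
have restE B : rest B = (d B + s B)%E by exact: measure_addE.
have {}muE B : measurable B -> mu B = (i B + rest B)%E.
  by move=> mB; rewrite restE addeA muE.
have [||B [BH Bh BL iB]] := max_mass_lim_component (@nondecreasing_set0 R) muE.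
- by rewrite isq.
- by rewrite -[RHS]iL isq.
have mB n : measurable (B n) by have [j /closed_union_of_measurable] := BH n.
move: BL iB; have : measurable (\bigcup_n B n) by exact: bigcup_measurable.
have muU := @max_mass_lim_bigcup_le R _ (@nondecreasing_set0 R) mu (fun n => A `|` B n).
move: muU; rewrite bigcupUr; last by exists 0%N.
set U := \bigcup_n B n => muU mU BL iB HA mD.
have mA := closed_union_of_measurable HA.
(* The sets [A]|[B n] compete for [LIS_infty mu], so adding this mass to [mu U] gives at most
   [mu U]. *)
have AU0 : mu (A `\` U) = 0%E.
  have mAU : measurable (A `\` U) by exact: measurableD.
  apply/eqP; rewrite -measure_le0 -(@leeD2rE _ (mu U)) ?fin_num_measure//.
  rewrite add0e [leRHS]BL -(measureU mu mAU mU); last by rewrite setDKI.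
  rewrite setDE setUIl setUCl setIT.
  apply: muU => [n|m n mn]; last by apply: setUS; exact: Bh.
  by have [j Bj] := BH n; exists (k + j)%N; exact: closed_union_ofU.
have mAD : measurable (A `&` D) by exact: measurableI.
rewrite iB// [RHS](measureDI mu mAD mU) [X in (X + _)%E](_ : _ = 0%E) ?add0e//.
apply: (subset_measure0 _ _ _ AU0); [exact: measurableD..|].
by apply: setSD; exact: subIsetl.
Qed.

Lemma mu_incr_comonotone (R : realType) (mu : prePermuton R) :
  LIS_infty mu = LIS mu 1%N -> forall e, 0 < e ->
  exists A, closed_union_of (@nondecreasing_set R) 1 A /\
            (mu_incr mu (~` A) <= e%:E)%E.
Proof.
move=> h e e0.
have [_] := mu_incr_setT mu; rewrite h => iL.
have Lfin : LIS mu 1%N \is a fin_num by rewrite -iL fin_num_measure.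
have [_ [A HA <-] Ae] := ub_ereal_sup_adherent e0 Lfin.
exists A; split => //.
have mA := closed_union_of_measurable HA.
have AE : mu_incr mu A = mu A.
  by have := mu_incr_closed_union mu HA measurableT; rewrite setIT.
have LE : LIS mu 1%N = (mu_incr mu (~` A) + mu A)%E.
  rewrite -iL -AE; apply: etrans (measureDI (mu_incr mu) measurableT mA) _.
  by rewrite setTD setTI.
have /ltW : (LIS mu 1%N - e%:E < mu A)%E := Ae.
by rewrite LE leeBlDr// addeC leeD2lE// fin_num_measure.
Qed.

(** No closed nondecreasing set captures more than the increasing part of [D], since [mu] and
    [mu_incr mu] agree on such sets. One set carrying [mu_incr mu] up to [e] is nearly optimal for
    every [D] at once. *)
Lemma LIS_mrestr (R : realType) (mu : prePermuton R) D (mD : measurable D) :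
  LIS_infty mu = LIS mu 1%N -> LIS (mrestr mu mD) 1%N = mu_incr mu D.
Proof.
move=> h; apply/eqP; rewrite eq_le; apply/andP; split.
  apply: (max_mass_le (@nondecreasing_set0 R)) => A HA.
  have mA := closed_union_of_measurable HA.
  rewrite /= /mrestr -(mu_incr_closed_union mu HA mD).
  by apply: le_measure; rewrite ?inE//; exact: measurableI.
apply/lee_addgt0Pr => e /(mu_incr_comonotone h)[A [HA Ae]].
have mA := closed_union_of_measurable HA.
apply: (@le_trans _ _ (mu_incr mu (A `&` D) + mu_incr mu (D `\` A))%E).
  by rewrite [leLHS](measureDI _ mD mA) addeC setIC.
apply: leeD.
  rewrite (mu_incr_closed_union mu HA mD).
  exact: (max_mass_ge (mrestr mu mD) HA).
apply: le_trans Ae; apply: le_measure; rewrite ?inE//.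
  exact: measurableD.
exact: measurableC.
Qed.

(** * From equal shapes to equal masses *)

Lemma LIS_corner (R : realType) (mu : prePermuton R) :
  LIS (mrestr mu (measurable_corner 1 1)) = LIS mu.
Proof.
apply/funext => -[//|k]; congr ereal_sup; apply/seteqP; split => _ [A HA <-].
  by exists A => //=; rewrite /mrestr setIidl//; case: HA.
by exists A => //=; rewrite /mrestr setIidl//; case: HA.
Qed.

Lemma LIS_fin_num (R : realType) (mu : prePermuton R) D (mD : measurable D) k :
  LIS (mrestr mu mD) k \is a fin_num.
Proof.
rewrite ge0_fin_numE.
  apply: (@le_lt_trans _ _ 1%E); last exact: ltry.
  apply: (max_mass_le (@nondecreasing_set0 R)) => A /closed_union_of_measurable mA.
  by apply: probability_le1; exact: measurableI.
rewrite -(measure0 (mrestr mu mD)); apply: max_mass_ge.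
by apply: closed_union_of0; exact: nondecreasing_set0.
Qed.

(** Passes from the closed corners [C] seen by [RS] to the open half-planes [H] that determine a
    comonotone measure; [mu_incr mu] has no mass off the square. *)
Lemma mu_incr_square_compl (R : realType) (mu : prePermuton R) C H :
  measurable C -> measurable H -> C `<=` unit_square R ->
  H `&` unit_square R = unit_square R `\` C ->
  mu_incr mu H = (mu_incr mu (unit_square R) - mu_incr mu C)%E.
Proof.
move=> mC mH Csq HC; have mS := @measurable_unit_square R.
have mSC : measurable (~` unit_square R) by exact: measurableC.
have SC0 : mu_incr mu (~` unit_square R) = 0%E.
  have Too : (mu_incr mu setT < +oo)%E by rewrite -ge0_fin_numE// fin_num_measure.
  rewrite -setTD; apply: etrans (measureD measurableT mS Too) _.
  by rewrite setTI [X in (X - _)%E](mu_incr_setT mu).1 subee// fin_num_measure.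
have -> : mu_incr mu H = mu_incr mu (H `&` unit_square R).
  rewrite (measureDI (mu_incr mu) mH mS) [X in (X + _)%E](_ : _ = 0%E) ?add0e//.
  by apply: (subset_measure0 _ mSC _ SC0); [exact: measurableD|move=> p []].
rewrite HC measureD ?(setIidr Csq)//.
by rewrite -ge0_fin_numE// fin_num_measure.
Qed.

Lemma RS_shape_snd (R : realType) (mu nu : prePermuton R) y :
  RS mu = RS nu -> 0 <= y <= 1 -> Defs.shape mu 1 y = Defs.shape nu 1 y.
Proof.
move=> hRS y01; have y01' : y \in `[0%R : R, 1%R]%classic by rewrite inE/= in_itv.
by have /(congr1 (@^~ (SigSub y01'))) := congr1 fst hRS.
Qed.

Lemma RS_shape_fst (R : realType) (mu nu : prePermuton R) x :
  RS mu = RS nu -> 0 <= x <= 1 -> Defs.shape mu x 1 = Defs.shape nu x 1.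
Proof.
move=> hRS x01; have x01' : x \in `[0%R : R, 1%R]%classic by rewrite inE/= in_itv.
by have /(congr1 (@^~ (SigSub x01'))) := congr1 snd hRS.
Qed.

(** The shape at the corner (1, 1) lists the increments of [LIS], which starts at 0, so the sequence
    is recovered by summation. *)
Lemma RS_LIS (R : realType) (mu nu : prePermuton R) :
  RS mu = RS nu -> LIS mu = LIS nu.
Proof.
move=> hRS; apply/funext; elim=> [//|k IH].
have h : 0 <= (1 : R) <= 1 by rewrite ler01 lexx.
have := congr1 (@^~ k) (RS_shape_snd hRS h).
rewrite /Defs.shape !LIS_corner IH => /(congr1 (fun z => z + LIS nu k)%E).
have fin := LIS_fin_num nu (measurable_corner 1 1) k; rewrite LIS_corner in fin.
by rewrite !subeK.
Qed.

Theorem proposition2p15 (R : realType) (mu nu : prePermuton R)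
  (hLIS : LIS_infty mu = LIS mu 1%N)
  (hRS : RS mu = RS nu) :
  forall A : set (R * R)%type, measurable A -> mu_incr mu A = mu_incr nu A.
Proof.
(* The hypothesis on [mu] concerns only the sequence [LIS mu], which [nu] shares. *)
have nuLIS : LIS_infty nu = LIS nu 1%N.
  by rewrite /LIS_infty -(RS_LIS hRS).
have como (m : prePermuton R) :
    LIS_infty m = LIS m 1%N -> comonotone (mu_incr m).
  move=> h e /(mu_incr_comonotone h)[A [HA Ae]]; exists A; split => //.
    exact: closed_union_of_measurable HA.
  (* The union has a single piece, so both points lie in the same nondecreasing set. *)
  have [_ _ [F [FH ->]]] := HA => p q [i _ Fp] [j _ Fq].
  by apply: (FH i) => //; rewrite (ord1 i) -(ord1 j).
have shapeE (m : prePermuton R) x y : LIS_infty m = LIS m 1%N ->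
    Defs.shape m x y 0 = mu_incr m (`[0, x] `*` `[0, y]).
  (* Index 0 is the difference of [LIS] at 1 and at 0, and the latter is 0. *)
  by move=> h; rewrite /Defs.shape /= sube0; exact: LIS_mrestr.
have cornerx x : 0 <= x <= 1 ->
    mu_incr mu (`[0, x] `*` `[0, 1]) = mu_incr nu (`[0, x] `*` `[0, 1]).
  by move=> x01; rewrite -!shapeE// (RS_shape_fst hRS x01).
have cornery y : 0 <= y <= 1 ->
    mu_incr mu (`[0, 1] `*` `[0, y]) = mu_incr nu (`[0, 1] `*` `[0, y]).
  by move=> y01; rewrite -!shapeE// (RS_shape_snd hRS y01).
have half C H : measurable H -> measurable C -> C `<=` unit_square R ->
    H `&` unit_square R = unit_square R `\` C ->
    mu_incr mu C = mu_incr nu C -> mu_incr mu H = mu_incr nu H.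
  move=> mH mC CS HC E; rewrite !(mu_incr_square_compl _ mC mH CS HC) E.
  by rewrite /unit_square cornerx// ler01 lexx.
apply: comonotone_measure_unique; [exact: como|exact: como|move=> x|move=> y].
- have mH : measurable (`]x, +oo[%classic `*` [set: R]).
    by apply: measurableX => //; exact: measurable_itv.
  (* For negative [x] the half-plane contains the square, and the removed corner is empty. *)
  have [x0|x0] := ltP x 0.
    apply: (half set0) => //; rewrite ?measure0// setD0 setIidr//.
    move=> p [/=]; rewrite !in_itv/= => /andP[p0 _] _; split => //=.
    by rewrite andbT (lt_le_trans x0).
  (* [RS] is indexed by [0, 1], so [x] is truncated at 1; inside the square the abscissa is at most
     1, hence the complement of the corner is unchanged. *)
  have h : 0 <= Num.min x 1 <= 1 by rewrite le_min x0 ler01 ge_min lexx orbT.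
  apply: (half _ _ mH (measurable_corner (Num.min x 1) 1) _ _ (cornerx _ h)).
    move=> p [/=]; rewrite !in_itv/= le_min => /andP[p0 /andP[_ p1]] ?.
    by split => //=; rewrite in_itv/= p0.
  apply/seteqP; split => p.
    move=> [[xp _] Sp]; split => // -[+ _]; move: xp.
    by rewrite /= !in_itv/= andbT ltNge le_min => /negbTE ->; rewrite andbF.
  move=> [Sp Cp]; split => //; split => //=; rewrite ?in_itv/= andbT ltNge.
  apply/negP => px; apply: Cp; move: Sp => [/=]; rewrite !in_itv/= => /andP[p0 p1] ?.
  by split => //=; rewrite p0 le_min px.
- have mH : measurable ([set: R] `*` `]y, +oo[%classic).
    by apply: measurableX => //; exact: measurable_itv.
  (* The same two cases with the coordinates exchanged. *)
  have [y0|y0] := ltP y 0.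
    apply: (half set0) => //; rewrite ?measure0// setD0 setIidr//.
    move=> p [/=]; rewrite !in_itv/= => _ /andP[p0 _]; split => //=.
    by rewrite andbT (lt_le_trans y0).
  have h : 0 <= Num.min y 1 <= 1 by rewrite le_min y0 ler01 ge_min lexx orbT.
  apply: (half _ _ mH (measurable_corner 1 (Num.min y 1)) _ _ (cornery _ h)).
    move=> p [/=] ?; rewrite !in_itv/= le_min => /andP[p0 /andP[_ p1]].
    by split => //=; rewrite in_itv/= p0.
  apply/seteqP; split => p.
    move=> [[_ yp] Sp]; split => // -[_ +]; move: yp.
    by rewrite /= !in_itv/= andbT ltNge le_min => /negbTE ->; rewrite andbF.
  move=> [Sp Cp]; split => //; split => //=; rewrite ?in_itv/= andbT ltNge.
  apply/negP => py; apply: Cp; move: Sp => [/=] ?; rewrite !in_itv/= => /andP[p0 p1].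
  by split => //=; rewrite p0 le_min py.
Qed.
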